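(* Let $(G,E)$ be a pseudo-free self-similar graph, where $E$ is a source-free, finite directed graph and $G$ is an abelian discrete countable group with an element of infinite order. Then $\mathcal{S}_{\mathrm{sym}}$ is an open abelian normal subgroupoid of $\operatorname{Iso}(\mathcal{G}_{G,E})^\circ$ and $$\operatorname{Iso}(\mathcal{G}_{G,E})^\circ=\mathcal{S}_{\mathrm{sym}}\ \bigsqcup\ \Bigl(\bigcup_{(\alpha,g,\beta)}\mathcal{Z}(\alpha,g,\beta)\Bigr),$$ where the union is over all non-symmetric cycline triples $(\alpha,g,\beta)$. Moreover, $\mathcal{Z}(\alpha,g,\beta)$ is a singleton for every non-symmetric cycline triple $(\alpha,g,\beta)$.
   Context: Graphs. $\mathbb{N}=\{0,1,2,\dots\}$. A directed graph $E=(E^0,E^1,r,s)$ has vertex set $E^0$, edge set $E^1$, range and source maps $r,s\colon E^1\to E^0$. It is finite if $E^0,E^1$ are finite, and source-free if every vertex is the range of some edge. A path of length $n\ge1$ is a word $e_1\cdots e_n$ of edges with $s(e_i)=r(e_{i+1})$, with range $r(e_1)$ and source $s(e_n)$; vertices are the paths of length $0$. $E^*$ is the set of finite paths, $|\mu|$ the length. $E^\infty$ is the set of infinite paths $x=e_1e_2\cdots$ ($s(e_i)=r(e_{i+1})$), $r(x)=r(e_1)$; $x(m,n)=e_{m+1}\cdots e_n$ for $m<n$, $x(n,n)=r(e_{n+1})$. $vE^\infty$ is the set of infinite paths with range $v$. Self-similar graph $(G,E)$: $G$ acts on $E^*$ by bijections preserving lengths and commuting with $r,s$, with a restriction map $G\times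 E^*\to G$, $(g,\mu)\mapsto g|_\mu$, such that $(gh)|_\mu=g|_{h\cdot\mu}h|_\mu$; $g|_v=g$ for $v\in E^0$; $1_G|_\mu=1_G$; $g|_{\mu\nu}=g|_\mu|_\nu$ and $g\cdot(\mu\nu)=(g\cdot\mu)(g|_\mu\cdot\nu)$ whenever $s(\mu)=r(\nu)$. The action extends to $E^\infty$ by $(g\cdot x)(p,q)=g|_{x(0,p)}\cdot x(p,q)$, and $g|_x\colon\mathbb{N}\to G$ is $p\mapsto g|_{x(0,p)}$. $(G,E)$ is pseudo-free if $g\cdot\mu=\mu$ and $g|_\mu=1_G$ imply $g=1_G$. Groupoid. $Q(\mathbb{N},G)$ is the group of functions $\mathbb{N}\to G$ (pointwise product) modulo eventual equality, $[f]$ the class of $f$. For $n\in\mathbb{Z}$, $\mathcal{T}_n(f)(p)=f(p-n)$ if $p\ge n$ and $1_G$ otherwise, inducing an automorphism $\mathcal{T}_n$ of $Q(\mathbb{N},G)$. Then $$\mathcal{G}_{G,E}=\{(\mu(g\cdot x);\mathcal{T}_{|\mu|}([g|_x]),|\mu|-|\nu|;\nu x): g\in G,\ \mu,\nu\in E^*,\ s(\mu)=g\cdot s(\nu),\ x\in s(\nu)E^\infty\}$$ with $r(x;[f],k;y)=(x;[1_G],0;x)$, $s(x;[f],k;y)=(y;[1_G],0;y)$, product $(x;[f],k;y)(y;[h],l;z)=(x;[f]\mathcal{T}_k([h]),k+l;z)$, inverse $(y;\mathcal{T}_{-k}([f]^{-1}),-k;x)$. Its topology is generated by the cylinder sets $\mathcal{Z}(\mu,g,\nu)=\{(\mu(g\cdot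 x);\mathcal{T}_{|\mu|}([g|_x]),|\mu|-|\nu|;\nu x):x\in s(\nu)E^\infty\}$ with $s(\mu)=g\cdot s(\nu)$. $\operatorname{Iso}(\mathcal{G})=\{\mathfrak g:r(\mathfrak g)=s(\mathfrak g)\}$, and $\operatorname{Iso}(\mathcal{G})^\circ$ is its interior in $\mathcal{G}$. Cycline triples. $(\mu,g,\nu)$ with $\mu,\nu\in E^*$, $g\in G$ is a cycline triple (at $s(\nu)$) if $s(\mu)=g\cdot s(\nu)$ and $\mu(g\cdot x)=\nu x$ for all $x\in s(\nu)E^\infty$. It is symmetric if $\mu=\nu$. $\mathcal{S}_{\mathrm{sym}}$ is the union of the sets $\mathcal{Z}(\mu,g,\mu)$ over all symmetric cycline triples $(\mu,g,\mu)$. A subgroupoid $\mathcal{S}\subseteq\operatorname{Iso}(\mathcal{G})$ is abelian if any two composable elements of it commute. A subgroupoid $\mathcal{S}$ with $\mathcal{G}^{(0)}\subseteq\mathcal{S}\subseteq\operatorname{Iso}(\mathcal{G})$ is normal in $\mathcal{G}$ if $\mathfrak g\mathfrak t\mathfrak g^{-1}\in\mathcal{S}$ for all $\mathfrak g\in\mathcal{G}$ and $\mathfrak t\in\mathcal{S}$ with $r(\mathfrak t)=s(\mathfrak g)$. *)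

(* Defs.v *)
From HB Require Import structures.
From mathcomp Require Import all_boot all_order all_algebra.
From mathcomp Require Import all_classical all_reals all_analysis.
From mathcomp Require Import zify.
Set Implicit Arguments.
Unset Strict Implicit.
Unset Printing Implicit Defensive.
Import Order.TTheory GRing.Theory Num.Theory.
Local Open Scope classical_set_scope.
Local Open Scope group_scope.

Record finDigraph := FinDigraph {
  vertex : finType;
  edge : finType;
  rng : edge -> vertex;
  src : edge -> vertex }.

Definition source_free (E : finDigraph) := forall v : vertex E,
  exists e : edge E, rng e = v.

(* words e_1 e_2 ... with rng e_1 = v and src e_i = rng e_(i+1) *)
Fixpoint is_path (E : finDigraph) (v : vertex E) (w : seq (edge E)) : bool :=
  if w is e :: w' then (rng e == v) && is_path (src e) w' else true.

(* E^*: the range is stored so that the paths of length 0 are the vertices. *)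
Record finpath (E : finDigraph) := FinPath {
  pval : vertex E * seq (edge E);
  _ : is_path pval.1 pval.2 }.

HB.instance Definition _ (E : finDigraph) := [isSub for @pval E].
HB.instance Definition _ (E : finDigraph) := [Choice of finpath E by <:].

Definition prng (E : finDigraph) (mu : finpath E) : vertex E := (pval mu).1.
Definition word (E : finDigraph) (mu : finpath E) : seq (edge E) := (pval mu).2.
Definition plen (E : finDigraph) (mu : finpath E) : nat := size (word mu).
Definition psrc (E : finDigraph) (mu : finpath E) : vertex E :=
  last (prng mu) [seq src e | e <- word mu].

Definition vpath (E : finDigraph) (v : vertex E) : finpath E :=
  @FinPath E (v, [::]) isT.

(* Concatenation; only meaningful when psrc mu = prng nu (junk value: mu). *)
Definition pcat (E : finDigraph) (mu nu : finpath E) : finpath E :=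
  insubd mu (prng mu, word mu ++ word nu).

(* E^oo, indexed from 0: x n is the edge e_(n+1). *)
Record infpath (E : finDigraph) := InfPath {
  ival :> nat -> edge E;
  ivalP : `[< forall n, src (ival n) = rng (ival n.+1) >] }.

HB.instance Definition _ (E : finDigraph) := [isSub for @ival E].
HB.instance Definition _ (E : finDigraph) := [Choice of infpath E by <:].

Definition irng (E : finDigraph) (x : infpath E) : vertex E := rng (x 0).

(* mu x; only meaningful when psrc mu = irng x (junk value: x). *)
Definition icat (E : finDigraph) (mu : finpath E) (x : infpath E) : infpath E :=
  insubd x (fun n => if (n < plen mu)%N then nth (x 0) (word mu) n
                     else x (n - plen mu)%N).

Section Paths.
Variable E : finDigraph.
Implicit Types (mu nu lam : finpath E) (x y z : infpath E).

Lemma infpathP x n : src (x n) = rng (x n.+1).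
Proof. by move: (ivalP x) => /asboolP. Qed.

Lemma infpath_ext x y : x =1 y -> x = y.
Proof. by move=> xy; apply: val_inj; apply/funext. Qed.

Lemma finpath_ext mu nu : prng mu = prng nu -> word mu = word nu -> mu = nu.
Proof.
case: mu nu => [[v w] p] [[v' w'] p']; rewrite /prng /word /= => vv ww.
by apply: val_inj => /=; rewrite vv ww.
Qed.

Lemma finpathP mu : is_path (prng mu) (word mu).
Proof. by case: mu. Qed.

Lemma is_path_cat (v : vertex E) w w' : is_path v (w ++ w') =
  is_path v w && is_path (last v [seq src e | e <- w]) w'.
Proof. by elim: w v => //= e w IH v; rewrite IH andbA. Qed.

Lemma is_path_iota x m k :
  is_path (rng (x m)) [seq x i | i <- iota m k].
Proof.
by elim: k m => //= k IH m; rewrite eqxx infpathP IH.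
Qed.

(* x(m,n), for m <= n *)
Definition segment x (m n : nat) : finpath E :=
  @FinPath E (rng (x m), [seq x i | i <- iota m (n - m)])
    (is_path_iota x m (n - m)).

Lemma pcatE mu nu : psrc mu = prng nu ->
  pval (pcat mu nu) = (prng mu, word mu ++ word nu).
Proof.
move=> h; rewrite /pcat val_insubd /= is_path_cat finpathP /=.
by rewrite -/(psrc mu) h finpathP.
Qed.

Lemma prng_pcat mu nu : psrc mu = prng nu -> prng (pcat mu nu) = prng mu.
Proof. by move=> h; rewrite /prng pcatE. Qed.

Lemma word_pcat mu nu : psrc mu = prng nu ->
  word (pcat mu nu) = word mu ++ word nu.
Proof. by move=> h; rewrite /word pcatE. Qed.

Lemma plen_pcat mu nu : psrc mu = prng nu ->
  plen (pcat mu nu) = (plen mu + plen nu)%N.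
Proof. by move=> h; rewrite /plen word_pcat // size_cat. Qed.

Lemma psrc_pcat mu nu : psrc mu = prng nu -> psrc (pcat mu nu) = psrc nu.
Proof.
move=> h; rewrite /psrc prng_pcat // word_pcat // map_cat last_cat.
by rewrite -/(psrc mu) h.
Qed.

Lemma plen_segment x m n : plen (segment x m n) = (n - m)%N.
Proof. by rewrite /plen /= size_map size_iota. Qed.

Lemma psrc_segment x m n : (m <= n)%N -> psrc (segment x m n) = rng (x n).
Proof.
move=> mn; rewrite /psrc /segment /prng /word /= -map_comp.
have {2}-> : n = (m + (n - m))%N by rewrite subnKC.
case: (n - m)%N => [|k]; first by rewrite addn0.
by rewrite -[k.+1]addn1 iotaD map_cat last_cat /= addnA addn1 infpathP.
Qed.

Lemma segmentD x m n p : (m <= n)%N -> (n <= p)%N ->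
  segment x m p = pcat (segment x m n) (segment x n p).
Proof.
move=> mn np; have h := psrc_segment x mn.
apply: finpath_ext; first by rewrite prng_pcat.
rewrite word_pcat // /word /= -map_cat; congr map.
rewrite -{2}(subnKC mn) -iotaD; congr iota.
by rewrite addnBAC ?(leq_trans mn) // subnKC // (leq_trans mn).
Qed.

Lemma segment_vpath x n : segment x n n = vpath (rng (x n)).
Proof. by apply: finpath_ext => //; rewrite /word /= subnn. Qed.

Lemma infpath_segment_ext k x y :
  (forall n, segment x 0 (k + n) = segment y 0 (k + n)) -> x = y.
Proof.
move=> h; apply: infpath_ext => n; have := congr1 (@word E) (h n.+1).
rewrite /word /= !subn0 => /(congr1 (fun s => nth (x n) s n)).
by rewrite !(nth_map 0%N) ?size_iota ?addnS ?ltnS ?leq_addl // nth_iota //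
  ltnS leq_addl.
Qed.

Lemma icatE mu x : psrc mu = irng x -> ival (icat mu x) =
  (fun n => if (n < plen mu)%N then nth (x 0) (word mu) n
            else x (n - plen mu)%N).
Proof.
move=> h; rewrite /icat val_insubd ifT //; apply/asboolP => n.
have := finpathP mu; move: h; rewrite /psrc /plen /prng.
case: (pval mu) => v /= _; elim: (word mu) v n => [|e w IH] v n /=.
  by move=> _ _; rewrite !subn0 infpathP.
move=> h /andP[/eqP _ pw]; case: n => [|n] /=; last exact: IH h pw.
case: w pw h {IH} => [|f w] /=; first by move=> _ ->; rewrite subnn.
by move=> /andP[/eqP ->].
Qed.

Lemma irng_icat mu x : psrc mu = irng x -> irng (icat mu x) = prng mu.
Proof.
move=> h; rewrite /irng icatE //; move: (finpathP mu) h.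
rewrite /plen /psrc; case: (word mu) => [_ /= -> //|e w /=].
by move=> /andP[/eqP].
Qed.

Lemma segment_icat mu x n : psrc mu = irng x ->
  segment (icat mu x) 0 (plen mu + n) = pcat mu (segment x 0 n).
Proof.
move=> h; apply: finpath_ext.
  by rewrite prng_pcat // -(irng_icat h).
rewrite word_pcat // {1 3}/word /= icatE // !subn0 iotaD map_cat add0n.
congr (_ ++ _); last first.
  rewrite -[plen mu]addn0 iotaDl -map_comp; apply: eq_map => i /=.
  by rewrite addn0 ltnNge leq_addr /= addKn.
apply: (@eq_from_nth _ (x 0%N)); rewrite size_map size_iota // => i im.
by rewrite (nth_map 0%N) ?size_iota // nth_iota // add0n im.
Qed.

Lemma segment0_icat mu x : psrc mu = irng x ->
  segment (icat mu x) 0 (plen mu) = mu.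
Proof.
move=> h; rewrite -[plen mu]addn0 segment_icat // segment_vpath.
by apply: finpath_ext; rewrite ?prng_pcat ?word_pcat ?cats0.
Qed.

Lemma icat_pcat mu nu x : psrc mu = prng nu -> psrc nu = irng x ->
  icat (pcat mu nu) x = icat mu (icat nu x).
Proof.
move=> h k; have hk : psrc mu = irng (icat nu x) by rewrite irng_icat.
have l : psrc (pcat mu nu) = irng x by rewrite psrc_pcat.
apply: (@infpath_segment_ext (plen (pcat mu nu))) => n.
rewrite segment_icat // plen_pcat // -addnA segment_icat //.
rewrite segment_icat //; apply: finpath_ext.
  by rewrite !prng_pcat.
by rewrite !word_pcat ?psrc_pcat ?prng_pcat ?catA.
Qed.

Lemma ishift_subproof x k :
  `[< forall n, src (x (k + n)%N) = rng (x (k + n.+1)%N) >].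
Proof. by apply/asboolP => n; rewrite addnS infpathP. Qed.

Lemma icat_drop x k :
  icat (segment x 0 k) (InfPath (ishift_subproof x k)) = x.
Proof.
apply: infpath_ext => n; rewrite icatE; last first.
  by rewrite psrc_segment // /irng /= addn0.
rewrite plen_segment subn0; case: ltnP => nk; last by rewrite /= subnKC.
by rewrite /word /= subn0 (nth_map 0%N) ?size_iota // nth_iota.
Qed.

Lemma icat_inj mu x y : psrc mu = irng x -> psrc mu = irng y ->
  icat mu x = icat mu y -> x = y.
Proof.
move=> hx hy xy; apply: infpath_ext => n.
have := congr1 (fun z : infpath E => z (plen mu + n)%N) xy.
by rewrite /= !icatE // ltnNge leq_addr /= addKn.
Qed.

Lemma icat_prefix mu nu x z : psrc mu = irng x -> psrc nu = irng z ->
  icat mu x = icat nu z -> (plen mu <= plen nu)%N ->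
  exists lam, [/\ psrc mu = prng lam, psrc lam = irng z,
    nu = pcat mu lam & x = icat lam z].
Proof.
move=> hx hz xz le; pose k := (plen nu - plen mu)%N.
have nuE : nu = pcat mu (segment x 0 k).
  by rewrite -segment_icat // xz subnKC // segment0_icat.
have hl : psrc (segment x 0 k) = irng z.
  by rewrite -hz [in RHS]nuE psrc_pcat.
exists (segment x 0 k); split=> //.
apply: (@icat_inj mu) => //; first by rewrite irng_icat.
by rewrite -icat_pcat // -nuE.
Qed.

Lemma icat_vpath (v : vertex E) x : v = irng x -> icat (vpath v) x = x.
Proof. by move=> h; apply: infpath_ext => n; rewrite icatE //= subn0. Qed.

End Paths.

(* In act_rng and act_src a vertex v is acted on as the path vpath v.  The  *)
(* first conjunct of act_cat says that the right-hand concatenation makes   *)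
(* sense, which the equation presupposes.                                   *)
Record selfSimilarGraph (G : groupType) (E : finDigraph) := SelfSimilarGraph {
  act : G -> finpath E -> finpath E;
  restr : G -> finpath E -> G;
  act1 : forall mu, act 1 mu = mu;
  actM : forall g h mu, act (g * h) mu = act g (act h mu);
  plen_act : forall g mu, plen (act g mu) = plen mu;
  act_rng : forall g mu, vpath (prng (act g mu)) = act g (vpath (prng mu));
  act_src : forall g mu, vpath (psrc (act g mu)) = act g (vpath (psrc mu));
  restrM : forall g h mu, restr (g * h) mu = restr g (act h mu) * restr h mu;
  restr_vpath : forall g v, restr g (vpath v) = g;
  restr1 : forall mu, restr 1 mu = 1;
  restr_cat : forall g mu nu, psrc mu = prng nu ->
    restr g (pcat mu nu) = restr (restr g mu) nu;
  act_cat : forall g mu nu, psrc mu = prng nu ->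
    psrc (act g mu) = prng (act (restr g mu) nu) /\
    act g (pcat mu nu) = pcat (act g mu) (act (restr g mu) nu) }.

Definition pseudo_free (G : groupType) (E : finDigraph)
    (X : selfSimilarGraph G E) :=
  forall g mu, act X g mu = mu -> restr X g mu = 1 -> g = 1.

Section InfiniteAction.
Variables (G : groupType) (E : finDigraph) (X : selfSimilarGraph G E).
Implicit Types (g h : G) (mu nu : finpath E) (x : infpath E).

Lemma restr_segmentD g x m n : (m <= n)%N ->
  restr X g (segment x 0 n) = restr X (restr X g (segment x 0 m)) (segment x m n).
Proof.
by move=> mn; rewrite (@segmentD _ x 0 m n) // restr_cat // psrc_segment.
Qed.

(* the edge (g . x)(n,n+1) = g|_x(0,n) . x(n,n+1); the default x n is unused *)
Definition iact_val g x n : edge E :=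
  nth (x n) (word (act X (restr X g (segment x 0 n)) (segment x n n.+1))) 0.

Lemma iact_subproof g x :
  `[< forall n, src (iact_val g x n) = rng (iact_val g x n.+1) >].
Proof.
apply/asboolP => n; rewrite /iact_val.
set h := restr X g (segment x 0 n).
have [] := @act_cat _ _ X h (segment x n n.+1) (segment x n.+1 n.+2).
  by rewrite psrc_segment.
rewrite -restr_segmentD //; set h' := restr X _ _ => + _.
have := plen_act X h (segment x n n.+1).
have := plen_act X h' (segment x n.+1 n.+2).
rewrite !plen_segment !subSnn /plen /psrc.
have := finpathP (act X h' (segment x n.+1 n.+2)).
case: (word (act X h _)) => [//|e [|//]].
by case: (word (act X h' _)) => [//|e' [|//]] /= /andP[/eqP <-].
Qed.

Definition iact g x : infpath E := InfPath (iact_subproof g x).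

(* g|_x *)
Definition irestr g x : nat -> G := fun p => restr X g (segment x 0 p).

Lemma segment_iact g x p q : (p <= q)%N ->
  segment (iact g x) p q = act X (restr X g (segment x 0 p)) (segment x p q).
Proof.
have one n : segment (iact g x) n n.+1 =
    act X (restr X g (segment x 0 n)) (segment x n n.+1).
  set m := act X _ _; have lm : plen m = 1%N.
    by rewrite plen_act plen_segment subSnn.
  move: lm (finpathP m); rewrite /plen => lm pm.
  apply: finpath_ext; rewrite /segment.
    rewrite {1}/prng /= /iact_val -/m.
    by case: (word m) lm pm => [|e [|//]] //= _ /andP[/eqP].
  rewrite {1}/word /= subSnn /= /iact_val -/m.
  by case: (word m) lm => [|e [|//]].
move=> pq; rewrite -(subnKC pq); elim: (q - p)%N => [|k IH].
  rewrite addn0 !segment_vpath.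
  have := act_rng X (restr X g (segment x 0 p)) (segment x p p.+1).
  by rewrite -one.
rewrite addnS !(@segmentD _ _ p (p + k) (p + k).+1) ?leq_addr //.
rewrite IH one (restr_segmentD _ _ (leq_addr k p)).
have [] := @act_cat _ _ X (restr X g (segment x 0 p)) (segment x p (p + k))
  (segment x (p + k) (p + k).+1).
  by rewrite psrc_segment // leq_addr.
by move=> _ ->.
Qed.

Lemma segment0_iact g x n : segment (iact g x) 0 n = act X g (segment x 0 n).
Proof. by rewrite segment_iact // segment_vpath restr_vpath. Qed.

Lemma irng_iact g x : vpath (irng (iact g x)) = act X g (vpath (irng x)).
Proof. by rewrite -!segment_vpath segment0_iact. Qed.

Lemma iact1 x : iact 1 x = x.
Proof.
by apply: (@infpath_segment_ext _ 0) => n; rewrite segment0_iact act1.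
Qed.

Lemma iactM g h x : iact (g * h) x = iact g (iact h x).
Proof.
by apply: (@infpath_segment_ext _ 0) => n; rewrite !segment0_iact actM.
Qed.

Lemma vpath_inj : injective (@vpath E).
Proof. by move=> v w /(congr1 (@prng E)). Qed.

Lemma act_composable g mu x : psrc mu = irng x ->
  psrc (act X g mu) = irng (iact (restr X g mu) x).
Proof.
move=> h; have [//|+ _] := @act_cat _ _ X g mu (vpath (irng x)).
move=> ->; apply: vpath_inj; rewrite irng_iact.
by rewrite act_rng.
Qed.

Lemma iact_icat g mu x : psrc mu = irng x ->
  iact g (icat mu x) = icat (act X g mu) (iact (restr X g mu) x).
Proof.
move=> h; apply: (@infpath_segment_ext _ (plen mu)) => n.
rewrite segment0_iact segment_icat // -(plen_act X g mu) segment_icat.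
  by rewrite segment0_iact; have [|_ ->] := @act_cat _ _ X g mu (segment x 0 n).
exact: act_composable.
Qed.

Lemma irestrM g h x p :
  irestr (g * h) x p = irestr g (iact h x) p * irestr h x p.
Proof. by rewrite /irestr restrM segment0_iact. Qed.

End InfiniteAction.

Section Germs.
Variable G : groupType.
Implicit Types f g : nat -> G.

Definition eventually_eq f g : bool := `[< \forall n \near \oo, f n = g n >].

Lemma eventually_eq_refl : reflexive eventually_eq.
Proof. by move=> f; apply/asboolP; near=> n. Unshelve. all: by end_near. Qed.

Lemma eventually_eq_sym : symmetric eventually_eq.
Proof.
by move=> f g; apply/asboolP/asboolP; apply: filterS => n ->.
Qed.

Lemma eventually_eq_trans : transitive eventually_eq.
Proof.
move=> f g h /asboolP gf /asboolP fh; apply/asboolP.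
by move: gf fh; apply: filterS2 => n -> ->.
Qed.

Canonical eventually_eq_equiv := EquivRel eventually_eq
  eventually_eq_refl eventually_eq_sym eventually_eq_trans.

(* Q(N,G) *)
Definition germ := {eq_quot eventually_eq}%qT.
HB.instance Definition _ := Choice.on germ.
HB.instance Definition _ := EqQuotient.on germ.

Definition germ_of f : germ := \pi_germ%qT f.

Lemma germ_ofP f g :
  germ_of f = germ_of g <-> \forall n \near \oo, f n = g n.
Proof. by split=> [/eqmodP/asboolP|h] //; apply/eqmodP/asboolP. Qed.

Lemma germ_of_surj (a : germ) : exists f, a = germ_of f.
Proof. by exists (repr a); rewrite /germ_of reprK. Qed.

Definition germ_mul (a b : germ) : germ :=
  germ_of (fun n => repr a n * repr b n).
Definition germ_inv (a : germ) : germ := germ_of (fun n => (repr a n)^-1).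

Lemma repr_germ_of f : \forall n \near \oo, repr (germ_of f) n = f n.
Proof. by apply/germ_ofP; rewrite /germ_of reprK. Qed.

Lemma germ_mul_of f g :
  germ_mul (germ_of f) (germ_of g) = germ_of (fun n => f n * g n).
Proof.
apply/germ_ofP; have := repr_germ_of f; have := repr_germ_of g.
by apply: filterS2 => n -> ->.
Qed.

Lemma germ_inv_of f : germ_inv (germ_of f) = germ_of (fun n => (f n)^-1).
Proof. by apply/germ_ofP; have := repr_germ_of f; apply: filterS => n ->. Qed.

Lemma germ_mulA : associative germ_mul.
Proof.
move=> a b c; have [[[f ->] [g ->]] [h ->]] :=
  (germ_of_surj a, germ_of_surj b, germ_of_surj c).
by rewrite !germ_mul_of; congr germ_of; apply/funext => n; rewrite mulgA.
Qed.

Lemma germ_mul1 : left_id (germ_of (fun=> 1)) germ_mul.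
Proof.
move=> a; have [f ->] := germ_of_surj a.
by rewrite germ_mul_of; congr germ_of; apply/funext => n; rewrite mul1g.
Qed.

Lemma germ_mulr1 : right_id (germ_of (fun=> 1)) germ_mul.
Proof.
move=> a; have [f ->] := germ_of_surj a.
by rewrite germ_mul_of; congr germ_of; apply/funext => n; rewrite mulg1.
Qed.

Lemma germ_mulV : left_inverse (germ_of (fun=> 1)) germ_inv germ_mul.
Proof.
move=> a; have [f ->] := germ_of_surj a; rewrite germ_inv_of germ_mul_of.
by congr germ_of; apply/funext => n; rewrite mulVg.
Qed.

Lemma germ_mulrV : right_inverse (germ_of (fun=> 1)) germ_inv germ_mul.
Proof.
move=> a; have [f ->] := germ_of_surj a; rewrite germ_inv_of germ_mul_of.
by congr germ_of; apply/funext => n; rewrite mulgV.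
Qed.

HB.instance Definition _ := isGroup.Build germ
  germ_mulA germ_mul1 germ_mulr1 germ_mulV germ_mulrV.

Lemma germ_of1 : germ_of (fun=> 1) = 1 :> germ.
Proof. by []. Qed.

Lemma germ_ofM f g : germ_of f * germ_of g = germ_of (fun n => f n * g n).
Proof. exact: germ_mul_of. Qed.

Lemma germ_ofV f : (germ_of f)^-1 = germ_of (fun n => (f n)^-1).
Proof. exact: germ_inv_of. Qed.

(* T_k, on functions and on Q(N,G) *)
Definition seq_shift (k : int) f : nat -> G :=
  fun p => if (k <= p%:Z)%R then f `|(p%:Z - k)%R|%N else 1.

Definition germ_shift (k : int) (a : germ) : germ := germ_of (seq_shift k (repr a)).

Lemma near_shift (k : int) (P : nat -> Prop) : (\forall n \near \oo, P n) ->
  \forall n \near \oo, (k <= n%:Z)%R /\ P `|(n%:Z - k)%R|%N.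
Proof.
move=> [N _ NP]; exists (N + `|k|)%N => // n /= Nn; split; first by lia.
by apply: NP => /=; lia.
Qed.

Lemma germ_shift_of k f : germ_shift k (germ_of f) = germ_of (seq_shift k f).
Proof.
apply/germ_ofP; apply: filterS (near_shift k (repr_germ_of f)) => n [kn].
by rewrite /seq_shift kn.
Qed.

Lemma germ_shiftM k (a b : germ) :
  germ_shift k (a * b) = germ_shift k a * germ_shift k b.
Proof.
have [[f ->] [g ->]] := (germ_of_surj a, germ_of_surj b).
rewrite (germ_ofM f) !(germ_shift_of k) germ_ofM; congr germ_of.
by apply/funext => n; rewrite /seq_shift; case: ifP => // _; rewrite mulg1.
Qed.

Lemma germ_shift1 k : germ_shift k 1 = 1.
Proof.
rewrite -germ_of1 germ_shift_of; congr germ_of; apply/funext => n.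
by rewrite /seq_shift if_same.
Qed.

Lemma germ_shiftV k (a : germ) : germ_shift k a^-1 = (germ_shift k a)^-1.
Proof.
by apply: (mulgI (germ_shift k a)); rewrite -germ_shiftM !mulgV germ_shift1.
Qed.

Lemma germ_shiftD k l (a : germ) :
  germ_shift k (germ_shift l a) = germ_shift (k + l)%R a.
Proof.
have [f ->] := germ_of_surj a; rewrite !germ_shift_of; apply/germ_ofP.
exists (`|k| + `|l|)%N => // n /= kln; rewrite /seq_shift.
by rewrite !ifT; [congr f| | |]; lia.
Qed.

Lemma germ_shift0 (a : germ) : germ_shift 0 a = a.
Proof.
have [f ->] := germ_of_surj a; rewrite germ_shift_of; congr germ_of.
by apply/funext => n; rewrite /seq_shift subr0.
Qed.

End Germs.

(* quadruples (x; [f], k; y), written as in qrng, qgerm, qlag, qsrc *)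
Record quad (G : groupType) (E : finDigraph) := Quad {
  qrng : infpath E;
  qgerm : germ G;
  qlag : int;
  qsrc : infpath E }.

HB.instance Definition _ G E := gen_eqMixin (quad G E).
HB.instance Definition _ G E := gen_choiceMixin (quad G E).

Definition quad_unit G E (x : infpath E) : quad G E := Quad x 1 0 x.
Definition quad_mul G E (a b : quad G E) : quad G E :=
  Quad (qrng a) (qgerm a * germ_shift (qlag a) (qgerm b))
    (qlag a + qlag b)%R (qsrc b).
Definition quad_inv G E (a : quad G E) : quad G E :=
  Quad (qsrc a) (germ_shift (- qlag a)%R (qgerm a)^-1) (- qlag a)%R (qrng a).

(* (mu(g.x); T_|mu| [g|_x], |mu| - |nu|; nu x), used when s(mu) = g.s(nu)    *)
(* and x is in s(nu)E^oo, which make mu(g.x) and nu x meaningful.            *)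
Definition gelt G E (X : selfSimilarGraph G E) (mu : finpath E) (g : G)
    (nu : finpath E) (x : infpath E) : quad G E :=
  Quad (icat mu (iact X g x))
    (germ_shift (plen mu)%:Z (germ_of (irestr X g x)))
    ((plen mu)%:Z - (plen nu)%:Z)%R
    (icat nu x).

Definition admissible G E (X : selfSimilarGraph G E) (mu : finpath E) (g : G)
    (nu : finpath E) :=
  vpath (psrc mu) = act X g (vpath (psrc nu)).

Definition groupoid_set G E (X : selfSimilarGraph G E) : set (quad G E) :=
  [set a | exists mu g nu x, [/\ admissible X mu g nu, psrc nu = irng x &
    a = gelt X mu g nu x]].

Record groupoid G E (X : selfSimilarGraph G E) := Groupoid {
  gval : quad G E;
  gvalP : `[< groupoid_set X gval >] }.

HB.instance Definition _ G E (X : selfSimilarGraph G E) :=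
  [isSub for @gval G E X].
HB.instance Definition _ G E (X : selfSimilarGraph G E) :=
  [Choice of groupoid X by <:].

Section Groupoid.
Variables (G : groupType) (E : finDigraph) (X : selfSimilarGraph G E).
Implicit Types (g h : G) (mu nu lam : finpath E) (x y : infpath E).
Implicit Types (a b : quad G E) (c d t : groupoid X).

Lemma admissible_icat mu g nu x : admissible X mu g nu -> psrc nu = irng x ->
  psrc mu = irng (iact X g x).
Proof. by move=> ad h; apply: vpath_inj; rewrite ad h irng_iact. Qed.

Lemma irestr_icat g mu x : psrc mu = irng x ->
  germ_of (irestr X g (icat mu x)) =
  germ_shift (plen mu)%:Z (germ_of (irestr X (restr X g mu) x)).
Proof.
move=> h; rewrite germ_shift_of; apply/germ_ofP.
exists (plen mu) => // n /= le; rewrite /seq_shift lez_nat le.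
have -> : (`|(n%:Z - (plen mu)%:Z)%R|%N = n - plen mu)%N by lia.
rewrite /irestr -{1}(subnKC le) segment_icat // restr_cat //.
Qed.

Lemma gelt_icat mu g nu lam x : admissible X mu g nu -> psrc nu = prng lam ->
  psrc lam = irng x ->
  gelt X mu g nu (icat lam x) =
  gelt X (pcat mu (act X g lam)) (restr X g lam) (pcat nu lam) x.
Proof.
move=> ad nl lx; have ml : psrc mu = prng (act X g lam).
  by apply: vpath_inj; rewrite ad nl act_rng.
have lx' := act_composable X g lx.
rewrite /gelt iact_icat // irestr_icat // germ_shiftD !plen_pcat // plen_act.
by rewrite !icat_pcat // !PoszD; congr Quad; lia.
Qed.

Lemma admissible_pcat mu g nu lam : admissible X mu g nu ->
  psrc nu = prng lam ->
  admissible X (pcat mu (act X g lam)) (restr X g lam) (pcat nu lam).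
Proof.
move=> ad nl; have ml : psrc mu = prng (act X g lam).
  by apply: vpath_inj; rewrite ad nl act_rng.
rewrite /admissible !psrc_pcat //.
have [//|-> _] := @act_cat _ _ X g lam (vpath (psrc lam)).
by rewrite act_rng.
Qed.

Lemma gelt_mul mu g nu h lam x :
  quad_mul (gelt X mu g nu (iact X h x)) (gelt X nu h lam x) =
  gelt X mu (g * h) lam x.
Proof.
rewrite /gelt /quad_mul /= iactM germ_shiftD subrK -germ_shiftM germ_ofM.
congr Quad; last by rewrite addrA subrK.
by congr (germ_shift _ (germ_of _)); apply/funext => p; rewrite irestrM.
Qed.

Lemma gelt_inv mu g nu x :
  quad_inv (gelt X mu g nu x) = gelt X nu g^-1 mu (iact X g x).
Proof.
rewrite /gelt /quad_inv /= -iactM mulVg iact1 -germ_shiftV germ_shiftD opprB.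
rewrite subrK germ_ofV; congr (Quad _ (germ_shift _ (germ_of _)) _ _).
apply/funext => p; apply: (mulIg (irestr X g x p)).
by rewrite mulVg -irestrM mulVg /irestr restr1.
Qed.

Lemma admissibleV mu g nu : admissible X mu g nu -> admissible X nu g^-1 mu.
Proof. by rewrite /admissible => ->; rewrite -actM mulVg act1. Qed.

Lemma admissibleM mu g nu h lam :
  admissible X mu g nu -> admissible X nu h lam -> admissible X mu (g * h) lam.
Proof. by rewrite /admissible actM => -> ->. Qed.

Lemma groupoid_set_unit x : groupoid_set X (quad_unit G x).
Proof.
exists (vpath (irng x)), 1, (vpath (irng x)), x; split=> //.
  by rewrite /admissible act1.
rewrite /gelt iact1 icat_vpath // subrr germ_shift0 /quad_unit -germ_of1.
congr (Quad _ (germ_of _) _ _).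
by apply/funext => p; rewrite /irestr restr1.
Qed.

Lemma groupoid_set_inv a : groupoid_set X a -> groupoid_set X (quad_inv a).
Proof.
move=> [mu [g [nu [x [ad nx ->]]]]]; rewrite gelt_inv.
exists nu, g^-1, mu, (iact X g x); split=> //; first exact: admissibleV.
exact: admissible_icat ad nx.
Qed.

Lemma quad_invK : involutive (@quad_inv G E).
Proof.
case=> x q k y; rewrite /quad_inv /= -germ_shiftV invgK germ_shiftD !opprK.
by rewrite subrr germ_shift0.
Qed.

Lemma quad_inv_mul a b :
  quad_inv (quad_mul a b) = quad_mul (quad_inv b) (quad_inv a).
Proof.
case: a b => [x q k y] [x' q' k' y']; rewrite /quad_inv /quad_mul /=.
rewrite invgM germ_shiftM -!germ_shiftV !germ_shiftD.
by congr Quad; [congr (germ_shift _ _ * germ_shift _ _)|]; lia.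
Qed.

Lemma groupoid_set_mul_le mu g nu x nu' h lam y :
  admissible X mu g nu -> psrc nu = irng x ->
  admissible X nu' h lam -> psrc lam = irng y ->
  icat nu x = icat nu' (iact X h y) -> (plen nu <= plen nu')%N ->
  groupoid_set X (quad_mul (gelt X mu g nu x) (gelt X nu' h lam y)).
Proof.
move=> ad nx ad' ly xy le; have ny := admissible_icat ad' ly.
have [z [nz zy nuE ->]] := icat_prefix nx ny xy le.
rewrite gelt_icat // -nuE gelt_mul.
exists (pcat mu (act X g z)), (restr X g z * h), lam, y; split=> //.
apply: admissibleM ad'; rewrite nuE; exact: admissible_pcat.
Qed.

Lemma groupoid_set_mul a b : groupoid_set X a -> groupoid_set X b ->
  qsrc a = qrng b -> groupoid_set X (quad_mul a b).
Proof.
move=> [mu [g [nu [x [ad nx ->]]]]] [nu' [h [lam [y [ad' ly ->]]]]] /= xy.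
have [le|/ltnW le] := leqP (plen nu) (plen nu').
  exact: groupoid_set_mul_le.
rewrite -[quad_mul _ _]quad_invK; apply: groupoid_set_inv.
rewrite quad_inv_mul !gelt_inv; apply: groupoid_set_mul_le => //.
- exact: admissibleV.
- exact: admissible_icat ad' ly.
- exact: admissibleV.
- exact: admissible_icat ad nx.
by rewrite -iactM mulVg iact1.
Qed.

Definition gunit x : groupoid X :=
  Groupoid (introT (asboolP _) (groupoid_set_unit x)).
Definition grng c : groupoid X := gunit (qrng (gval c)).
Definition gsrc c : groupoid X := gunit (qsrc (gval c)).

Lemma groupoidP c : groupoid_set X (gval c).
Proof. exact/asboolP/gvalP. Qed.

Definition ginv c : groupoid X :=
  Groupoid (introT (asboolP _) (groupoid_set_inv (groupoidP c))).

(* The product; only meaningful when gsrc c = grng d. *)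
Definition gmul c d : groupoid X := insubd c (quad_mul (gval c) (gval d)).

Lemma gunit_inj : injective gunit.
Proof. by move=> x y [->]. Qed.

Lemma gmulE c d : gsrc c = grng d ->
  gval (gmul c d) = quad_mul (gval c) (gval d).
Proof.
move=> /gunit_inj cd; rewrite /gmul val_insubd ifT //.
exact/asboolP/groupoid_set_mul/cd/groupoidP/groupoidP.
Qed.

Definition cylinder mu g nu : set (groupoid X) :=
  [set c | exists2 x, psrc nu = irng x & gval c = gelt X mu g nu x].

Definition cylinders : set (set (groupoid X)) :=
  [set Z | exists mu g nu, admissible X mu g nu /\ Z = cylinder mu g nu].

HB.instance Definition _ :=
  isSubBaseTopological.Build (groupoid X) cylinders id.

Definition units : set (groupoid X) := range gunit.

Definition Iso : set (groupoid X) := [set c | grng c = gsrc c].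

Definition subgroupoid (S : set (groupoid X)) : Prop :=
  (forall c d, S c -> S d -> gsrc c = grng d -> S (gmul c d)) /\
  (forall c, S c -> S (ginv c)).

Definition abelian_subgroupoid (S : set (groupoid X)) : Prop :=
  [/\ subgroupoid S, S `<=` Iso &
    forall c d, S c -> S d -> gsrc c = grng d -> gmul c d = gmul d c].

(* Normality relative to an ambient subgroupoid H, which is setT for         *)
(* normality in the whole groupoid; H `&` Iso is the isotropy of H.          *)
Definition normal_subgroupoid (S H : set (groupoid X)) : Prop :=
  [/\ subgroupoid S, units `<=` S, S `<=` H `&` Iso &
    forall c t, H c -> S t -> grng t = gsrc c -> S (gmul (gmul c t) (ginv c))].

Definition cycline mu g nu : Prop :=
  admissible X mu g nu /\
  forall x, psrc nu = irng x -> icat mu (iact X g x) = icat nu x.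

Definition Ssym : set (groupoid X) :=
  [set c | exists mu g, cycline mu g mu /\ cylinder mu g mu c].

Definition Snonsym : set (groupoid X) :=
  [set c | exists mu g nu,
     [/\ cycline mu g nu, mu <> nu & cylinder mu g nu c]].

End Groupoid.

Arguments Iso {G E} X.
Arguments Ssym {G E} X.
Arguments Snonsym {G E} X.
Arguments units {G E} X.
Arguments cylinder {G E} X.
Arguments cylinders {G E} X.

(* Main.v *)
Require Import Defs.
From HB Require Import structures.
From mathcomp Require Import all_boot all_order all_algebra.
From mathcomp Require Import all_classical all_reals all_analysis.
From mathcomp Require Import finmap zify.
Set Implicit Arguments.
Unset Strict Implicit.
Unset Printing Implicit Defensive.
Local Open Scope classical_set_scope.
Local Open Scope group_scope.

(** Everything is local.  Fix c in the groupoid and write c as the germ of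
    (alpha, g, beta); extending beta along the source of c by one more edge
    replaces alpha, g, beta by longer paths and a restriction of g.  The long
    triples obtained in this way depend on c alone: their paths are prefixes
    of the range and of the source of c, and their group element is a late
    value of a representative of the germ of c.  Hence any cylinder around c
    contains the cylinders of all long triples of c ([cylinder_near]), and so
    does any open set around c ([open_near]), because a property of all
    sufficiently long triples passes to finite intersections.

    A cylinder lies in Iso exactly when its triple is cycline
    ([cyclineP]).  So Iso° is the union of the cylinders of the cycline
    triples.  Prefixes of equal length of one infinite path are equal, so a
    non-symmetric cycline triple has paths of different lengths: the lag
    separates Ssym from the other part.

    The groupoid structure of Ssym is checked on triples.  Elements of Ssym
    with a common source have long triples with one and the same path mu
    ([Ssym_near]), and there products, inverses and conjugates are computed
    in G: the product of the germs of (mu, g, mu) and (mu, h, mu) is the germ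
    of (mu, gh, mu), and the conjugate of (beta, h, beta) by (alpha, g, beta)
    is (alpha, g h g^-1, alpha).

    For a non-symmetric cycline triple with the longer path on the right, say
    (alpha, g, alpha gamma), the equation alpha (g.x) = alpha gamma x says
    that g.x = gamma x for all x with range v = s(gamma).  The left side is
    isometric in x, whereas the right side delays the first disagreement of
    two paths by |gamma| > 0.  So two paths with range v never disagree
    ([isometry_shift_eq]). *)

(** * Infinite paths *)

Section Paths.
Variable E : finDigraph.
Implicit Types (v : vertex E) (mu nu : finpath E) (x y : infpath E).

Lemma infpath_from v : source_free E -> exists x, irng x = v.
Proof.
move=> /choice[f fP]; pose u n := f (iter n (@src E \o f) v).
have uP : `[< forall n, src (u n) = rng (u n.+1) >].
  by apply/asboolP => n; rewrite /u fP.
by exists (InfPath uP); rewrite /irng /= /u fP.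
Qed.

Definition tail x n : infpath E := InfPath (ishift_subproof x n).

Lemma psrc_prefix x n : psrc (segment x 0 n) = irng (tail x n).
Proof. by rewrite psrc_segment // /irng /= addn0. Qed.

Lemma tail_icat mu x : psrc mu = irng x -> tail (icat mu x) (plen mu) = x.
Proof.
move=> h; apply: infpath_ext => n.
by rewrite /= icatE // ltnNge leq_addr /= addKn.
Qed.

Lemma tailD x m n : tail (tail x m) n = tail x (m + n).
Proof. by apply: infpath_ext => i /=; rewrite addnA. Qed.

Lemma prefix_nth x y m n :
  segment x 0 m = segment y 0 m -> (n < m)%N -> x n = y n.
Proof.
move=> /(congr1 (@word E)); rewrite /word /= !subn0 => + nm.
move=> /(congr1 (fun s => nth (x 0) s n)).
by rewrite !(nth_map 0%N) ?size_iota // nth_iota.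
Qed.

End Paths.

Section Main.
Variables (G : groupType) (E : finDigraph) (X : selfSimilarGraph G E).
Implicit Types (g h : G) (mu nu : finpath E) (x y : infpath E).
Implicit Types (c d t : groupoid X).

(** * Long triples of an element *)

(** The long triples of c are indexed by the length n of the path on the
    right; the lag of c then determines the length of the path on the left.
    For large n the sum is nonnegative, and the absolute value only turns it
    into a natural number. *)
Definition range_len c (n : nat) : nat := `|(n%:Z + qlag (gval c))%R|%N.

Definition range_prefix c n : finpath E :=
  segment (qrng (gval c)) 0 (range_len c n).

Definition source_prefix c n : finpath E := segment (qsrc (gval c)) 0 n.

(** The representative of the germ is arbitrary, so that only the values for
    large n are meaningful. *)
Definition restr_at c n : G := repr (qgerm (gval c)) (range_len c n).

Lemma cylinder_extend mu g nu lam : admissible X mu g nu ->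
  psrc nu = prng lam ->
  cylinder X (pcat mu (act X g lam)) (restr X g lam) (pcat nu lam)
    `<=` cylinder X mu g nu.
Proof.
move=> ad nl d [x]; rewrite psrc_pcat // => lx dE.
by exists (icat lam x); [rewrite irng_icat | rewrite gelt_icat].
Qed.

(** An element of Z(mu, g, nu) is c = (mu(g.x); ...; nu x); its long triples
    are the extensions of (mu, g, nu) by prefixes lam of x, because
    mu(g.lam) and nu lam are prefixes of mu(g.x) and nu x. *)
Lemma cylinder_near mu g nu c : admissible X mu g nu -> cylinder X mu g nu c ->
  \forall n \near \oo,
    [/\ admissible X (range_prefix c n) (restr_at c n) (source_prefix c n),
        gval c = gelt X (range_prefix c n) (restr_at c n) (source_prefix c n)
          (tail (qsrc (gval c)) n) &
        cylinder X (range_prefix c n) (restr_at c n) (source_prefix c n)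
          `<=` cylinder X mu g nu].
Proof.
move=> ad [x nx cE]; have mx := admissible_icat ad nx.
have [N _ NP] := repr_germ_of (seq_shift (plen mu)%:Z (irestr X g x)).
exists (plen nu + N)%N => // n /= le_n.
have [k nE] : exists k, n = (plen nu + k)%N.
  by exists (n - plen nu)%N; lia.
have le_Nk : (N <= k)%N by lia.
have lenE : range_len c n = (plen mu + k)%N by rewrite /range_len cE /=; lia.
have nl : psrc nu = prng (segment x 0 k) by [].
have -> : restr_at c n = restr X g (segment x 0 k).
  rewrite /restr_at lenE cE /= germ_shift_of NP /=; last by lia.
  rewrite /seq_shift lez_nat leq_addr /irestr.
  by congr (restr X g (segment x 0 _)); lia.
have -> : source_prefix c n = pcat nu (segment x 0 k).
  by rewrite /source_prefix cE /= nE segment_icat.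
have -> : range_prefix c n = pcat mu (act X g (segment x 0 k)).
  by rewrite /range_prefix lenE cE /= segment_icat // segment0_iact.
split; [exact: admissible_pcat | | exact: cylinder_extend].
rewrite cE /= nE -tailD tail_icat // -gelt_icat ?psrc_prefix //.
by rewrite /tail icat_drop.
Qed.

Lemma groupoid_near c : \forall n \near \oo,
  admissible X (range_prefix c n) (restr_at c n) (source_prefix c n) /\
  gval c = gelt X (range_prefix c n) (restr_at c n) (source_prefix c n)
    (tail (qsrc (gval c)) n).
Proof.
have [mu [g [nu [x [ad nx cE]]]]] := groupoidP c.
have : cylinder X mu g nu c by exists x.
by move=> /(cylinder_near ad); apply: filterS => n [].
Qed.

(** * Interior of the isotropy *)

Lemma open_cylinder mu g nu : admissible X mu g nu -> open (cylinder X mu g nu).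
Proof.
move=> ad; exists [set cylinder X mu g nu]; last exact: bigcup_set1.
move=> _ ->; apply: (@finI_from1 _ _ (@cylinders G E X) id).
by exists mu, g, nu.
Qed.

Lemma open_near (A : set (groupoid X)) c : open A -> A c ->
  \forall n \near \oo,
    cylinder X (range_prefix c n) (restr_at c n) (source_prefix c n) `<=` A.
Proof.
move=> [B BI <-] [A0 BA0 A0c]; have [D DZ A0E] := BI _ BA0.
have : \forall n \near \oo, (\bigcap_(Z in [set` D]) [set m |
    cylinder X (range_prefix c m) (restr_at c m) (source_prefix c m) `<=` Z]) n.
  apply: filter_bigI => Z ZD.
  have /set_mem[mu [g [nu [ad ZE]]]] := DZ Z ZD.
  have : Z c by move: A0c; rewrite -A0E; apply.
  by rewrite ZE => /(cylinder_near ad); apply: filterS => n [].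
apply: filterS => n nD d cd; exists A0 => //; suff: A0 d by [].
by rewrite -A0E => Z ZD; apply: (nD Z ZD).
Qed.

Lemma IsoP c : Iso X c <-> qrng (gval c) = qsrc (gval c).
Proof. by split=> [/gunit_inj|h] //; rewrite /Iso /= /grng h. Qed.

Lemma cyclineP mu g nu :
  cycline X mu g nu <-> admissible X mu g nu /\ cylinder X mu g nu `<=` Iso X.
Proof.
split=> -[ad h]; split=> //.
  by move=> c [x nx cE]; apply/IsoP; rewrite cE /= h.
move=> x nx; have cP : `[< groupoid_set X (gelt X mu g nu x) >].
  by apply/asboolP; exists mu, g, nu, x.
by have /IsoP := h (Groupoid cP) (ex_intro2 _ _ x nx erefl).
Qed.

Lemma cylinder_sub_interior mu g nu :
  cycline X mu g nu -> cylinder X mu g nu `<=` (Iso X)°.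
Proof.
move=> /cyclineP[ad ZI] c Zc; rewrite /interior nbhsE.
by exists (cylinder X mu g nu) => //; split => //; exact: open_cylinder.
Qed.

Lemma interior_cycline c : (Iso X)° c -> exists mu g nu,
  cycline X mu g nu /\ cylinder X mu g nu c.
Proof.
rewrite /interior nbhsE => -[A [oA Ac] AI].
have [n [[ad cE] ZA]] := filter_ex (filterI (groupoid_near c) (open_near oA Ac)).
exists (range_prefix c n), (restr_at c n), (source_prefix c n); split.
  by apply/cyclineP; split => // d /ZA /AI.
by exists (tail (qsrc (gval c)) n); rewrite // psrc_prefix.
Qed.

Lemma cycline_plen_eq mu g nu x : psrc nu = irng x -> cycline X mu g nu ->
  plen mu = plen nu -> mu = nu.
Proof.
move=> nx [ad fixx] len; rewrite -(segment0_icat (admissible_icat ad nx)) len.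
by rewrite fixx // segment0_icat.
Qed.

(** * The groupoid of symmetric cycline triples *)

Lemma cycline_sym_fix mu g x : cycline X mu g mu -> psrc mu = irng x ->
  iact X g x = x.
Proof.
by move=> [ad fixx] mx; apply: (icat_inj _ mx (fixx x mx));
  apply: admissible_icat ad mx.
Qed.

Lemma SsymP c : Ssym X c <-> (Iso X)° c /\ qlag (gval c) = 0%R.
Proof.
split=> [[mu [g [cyc Zc]]]|[/interior_cycline[mu [g [nu [cyc Zc]]]] lag]].
  split; first exact: (cylinder_sub_interior cyc).
  by case: Zc => x _ ->; rewrite /= GRing.subrr.
have [x nx cE] := Zc; have mn : mu = nu.
  by apply: cycline_plen_eq nx cyc _; move: lag; rewrite cE /=; lia.
by exists mu, g; rewrite {2 4}mn.
Qed.

Lemma Ssym_Iso : Ssym X `<=` Iso X.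
Proof. by move=> c /SsymP[/interior_subset]. Qed.

(** At length n the triple of an element of Ssym depends, up to its group
    element, only on the source y.  So elements with the same source become
    comparable: for large n they have the same path and the same tail. *)
Lemma Ssym_near c y : Ssym X c -> qsrc (gval c) = y -> \forall n \near \oo,
  exists2 g, cycline X (segment y 0 n) g (segment y 0 n) &
    gval c = gelt X (segment y 0 n) g (segment y 0 n) (tail y n).
Proof.
move=> Sc <-; have /IsoP cI := Ssym_Iso Sc.
have /SsymP[+ lag] := Sc.
move=> /interior_cycline[mu [g [nu [/cyclineP[ad ZI] Zc]]]].
apply: filterS (cylinder_near ad Zc) => n.
have -> : range_prefix c n = source_prefix c n.
  by rewrite /range_prefix /source_prefix /range_len cI lag GRing.addr0.
move=> [ad' cE sub]; exists (restr_at c n) => //.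
by apply/cyclineP; split=> // d /sub /ZI.
Qed.

Lemma open_Ssym : open (Ssym X).
Proof.
have -> : Ssym X = \bigcup_(p in [set p : finpath E * G |
    cycline X p.1 p.2 p.1]) cylinder X p.1 p.2 p.1.
  apply/seteqP; split=> c; first by move=> [mu [g []]]; exists (mu, g).
  by move=> [[mu g] cyc Zc]; exists mu, g.
by apply: bigcup_open => -[mu g] [ad _]; exact: open_cylinder.
Qed.

(** A composable pair in Ssym has one base point, hence can be written with
    one path mu and one tail x, on which both group elements act trivially. *)
Lemma Ssym_pair c d : Ssym X c -> Ssym X d -> gsrc c = grng d ->
  exists mu g h x,
    [/\ psrc mu = irng x, cycline X mu g mu, cycline X mu h mu,
        gval c = gelt X mu g mu x & gval d = gelt X mu h mu x].
Proof.
move=> Sc Sd /gunit_inj cd; have /IsoP dI := Ssym_Iso Sd.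
have [n [[g gP cE] [h hP dE]]] := filter_ex
  (filterI (Ssym_near Sc (etrans cd dI)) (Ssym_near Sd erefl)).
exists (segment (qsrc (gval d)) 0 n), g, h, (tail (qsrc (gval d)) n).
by split=> //; rewrite psrc_prefix.
Qed.

Lemma cyclineM mu g h : cycline X mu g mu -> cycline X mu h mu ->
  cycline X mu (g * h) mu.
Proof.
move=> cg ch; split; first exact: admissibleM cg.1 ch.1.
by move=> x mx; rewrite iactM !(cycline_sym_fix _ mx).
Qed.

Lemma cyclineV mu g nu : cycline X mu g nu -> cycline X nu g^-1 mu.
Proof.
move=> [ad fixx]; split; first exact: admissibleV.
move=> x mx; have nx := admissible_icat (admissibleV ad) mx.
by rewrite -fixx // -iactM mulgV iact1.
Qed.

Lemma gval_gmul_sym c d mu g h x :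
  gsrc c = grng d -> psrc mu = irng x -> cycline X mu h mu ->
  gval c = gelt X mu g mu x -> gval d = gelt X mu h mu x ->
  gval (gmul c d) = gelt X mu (g * h) mu x.
Proof.
move=> cd mx ch cE dE.
by rewrite gmulE // cE dE -{1}(cycline_sym_fix ch mx) gelt_mul.
Qed.

Lemma subgroupoid_Ssym : subgroupoid (Ssym X).
Proof.
split=> [c d Sc Sd cd|c [mu [g [cyc [x mx cE]]]]].
  have [mu [g [h [x [mx cg ch cE dE]]]]] := Ssym_pair Sc Sd cd.
  exists mu, (g * h); split; first exact: cyclineM.
  by exists x => //; exact: gval_gmul_sym.
exists mu, g^-1; split; first exact: cyclineV.
by exists x => //=; rewrite cE gelt_inv (cycline_sym_fix cyc mx).
Qed.

Lemma abelian_Ssym :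
  (forall g h : G, g * h = h * g) -> abelian_subgroupoid (Ssym X).
Proof.
move=> Gcomm; split; [exact: subgroupoid_Ssym | exact: Ssym_Iso |].
move=> c d Sc Sd cd; have [mu [g [h [x [mx cg ch cE dE]]]]] := Ssym_pair Sc Sd cd.
have dc : gsrc d = grng c.
  have /IsoP cI := Ssym_Iso Sc; have /IsoP dI := Ssym_Iso Sd.
  by move/gunit_inj: cd => cd; rewrite /gsrc /grng -dI -cd cI.
apply: val_inj => /=; rewrite (gval_gmul_sym cd mx ch cE dE).
by rewrite (gval_gmul_sym dc mx cg dE cE) Gcomm.
Qed.

Lemma units_Ssym : units X `<=` Ssym X.
Proof.
move=> _ [x _ <-]; exists (vpath (irng x)), 1; split.
  by split=> [|y _]; rewrite ?iact1 // /admissible act1.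
exists x => //=; rewrite /gelt iact1 icat_vpath // GRing.subrr germ_shift0.
rewrite /quad_unit -germ_of1; congr (Quad _ (germ_of _) _ _).
by apply/funext => p; rewrite /irestr restr1.
Qed.

Lemma cycline_conj mu g nu h : admissible X mu g nu -> cycline X nu h nu ->
  cycline X mu (g * h * g^-1) mu.
Proof.
move=> ad ch; split.
  apply: admissibleM (admissibleV ad); exact: admissibleM ad ch.1.
move=> x mx; have nx := admissible_icat (admissibleV ad) mx.
by rewrite !iactM (cycline_sym_fix ch nx) -iactM mulgV iact1.
Qed.

Lemma Ssym_conj c t : Ssym X t -> grng t = gsrc c ->
  Ssym X (gmul (gmul c t) (ginv c)).
Proof.
move=> St tc; have /IsoP tI := Ssym_Iso St.
have tcq : qrng (gval t) = qsrc (gval c) by move/gunit_inj: tc.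
have [n [[ad cE] [h ch tE]]] := filter_ex (filterI (groupoid_near c)
  (Ssym_near St (etrans (esym tI) tcq))).
rewrite -/(source_prefix c n) in ch tE.
move: (range_prefix c n) (restr_at c n) ad cE => mu g ad cE.
have nx : psrc (source_prefix c n) = irng (tail (qsrc (gval c)) n).
  by rewrite psrc_prefix.
have hx := cycline_sym_fix ch nx.
move: (source_prefix c n) (tail (qsrc (gval c)) n) nx hx ad ch cE tE.
move=> nu x nx hx ad ch cE tE.
have ctE : gval (gmul c t) = gelt X mu (g * h) nu x.
  by rewrite gmulE // cE tE -{1}hx gelt_mul.
exists mu, (g * h * g^-1); split; first exact: cycline_conj ad ch.
exists (iact X g x); first exact: admissible_icat ad nx.
rewrite gmulE; last by rewrite /gsrc /grng ctE /= cE.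
rewrite ctE /= cE gelt_inv.
have {1}-> : x = iact X g^-1 (iact X g x) by rewrite -iactM mulVg iact1.
by rewrite gelt_mul.
Qed.

Lemma normal_Ssym (H : set (groupoid X)) : Ssym X `<=` H ->
  normal_subgroupoid (Ssym X) H.
Proof.
move=> SH; split.
- exact: subgroupoid_Ssym.
- exact: units_Ssym.
- by move=> c Sc; split; [exact: SH | exact: Ssym_Iso].
- by move=> c t _; exact: Ssym_conj.
Qed.

(** * Non-symmetric cycline triples *)

(** The prefix of x of length |gamma| + n is recovered from the prefix of
    length n, as g^-1 . (gamma x(0,n)); iterating from n = 0 determines x. *)
Lemma isometry_shift_eq g gamma x y : (0 < plen gamma)%N ->
  (forall z, psrc gamma = irng z -> iact X g z = icat gamma z) ->
  psrc gamma = irng x -> psrc gamma = irng y -> x = y.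
Proof.
move=> gamma_gt0 gE hx hy.
have step z n : psrc gamma = irng z -> segment z 0 (plen gamma + n) =
    act X g^-1 (pcat gamma (segment z 0 n)).
  by move=> hz; rewrite -segment_icat // -gE // segment0_iact -actM mulVg act1.
have xy m : segment x 0 (plen gamma * m) = segment y 0 (plen gamma * m).
  elim: m => [|m IH]; last by rewrite mulnS !step // IH.
  by rewrite muln0 !segment_vpath -/(irng x) -hx hy.
apply: infpath_ext => n; apply: prefix_nth (xy n.+1) _.
by rewrite leq_pmull.
Qed.

Lemma cycline_le_uniq mu g nu x y : cycline X mu g nu -> mu <> nu ->
  (plen mu <= plen nu)%N -> psrc nu = irng x -> psrc nu = irng y -> x = y.
Proof.
move=> [ad fixx] mn le nx ny; have mgx := admissible_icat ad nx.
have [lam [ml lx nuE _]] := icat_prefix mgx nx (fixx x nx) le.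
have nl : psrc nu = psrc lam by rewrite nuE psrc_pcat.
apply: (@isometry_shift_eq g lam) => //; rewrite -?nl //.
  rewrite lt0n; apply/eqP => /size0nil lam0; apply: mn.
  by rewrite nuE; apply: finpath_ext; rewrite ?prng_pcat ?word_pcat // lam0 cats0.
move=> z nz; have lz : psrc lam = irng z by rewrite -nl.
apply: (@icat_inj _ mu); rewrite ?irng_icat //; first exact: admissible_icat ad nz.
by rewrite -icat_pcat // -nuE fixx.
Qed.

(** If the path on the left is the longer one, [cycline_le_uniq] applies to
    the inverse triple (nu, g^-1, mu) and gives g.x = g.y. *)
Lemma cycline_uniq mu g nu x y : cycline X mu g nu -> mu <> nu ->
  psrc nu = irng x -> psrc nu = irng y -> x = y.
Proof.
move=> cyc mn nx ny; have [le|/ltnW le] := leqP (plen mu) (plen nu).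
  exact: cycline_le_uniq cyc mn le nx ny.
have gxy : iact X g x = iact X g y.
  apply: (cycline_le_uniq (cyclineV cyc) (nesym mn) le).
    exact: admissible_icat cyc.1 nx.
  exact: admissible_icat cyc.1 ny.
by rewrite -(iact1 X x) -(mulVg g) iactM gxy -iactM mulVg iact1.
Qed.

Lemma cylinder_nonsym_set1 mu g nu : source_free E ->
  cycline X mu g nu -> mu <> nu -> exists c, cylinder X mu g nu = [set c].
Proof.
move=> /(@infpath_from _ (psrc nu))[x /esym nx] cyc mn.
have cP : `[< groupoid_set X (gelt X mu g nu x) >].
  by apply/asboolP; exists mu, g, nu, x; split=> //; exact: cyc.1.
exists (Groupoid cP); apply/seteqP; split=> [d [y ny dE]|_ ->]; last by exists x.
by apply: val_inj; rewrite /= dE (cycline_uniq cyc mn nx ny).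
Qed.

Lemma interior_Iso : (Iso X)° = Ssym X `|` Snonsym X.
Proof.
apply/seteqP; split=> c.
  move=> /interior_cycline[mu [g [nu [cyc Zc]]]].
  have [mn|mn] := pselect (mu = nu); last by right; exists mu, g, nu.
  by left; exists mu, g; rewrite {2 4}mn.
by case=> [/SsymP[]|[mu [g [nu [cyc _]]]]] //; exact: cylinder_sub_interior.
Qed.

Lemma Ssym_Snonsym0 : Ssym X `&` Snonsym X = set0.
Proof.
apply/seteqP; split=> // c [/SsymP[_ lag] [mu [g [nu [cyc mn [x nx cE]]]]]].
by apply: mn; apply: cycline_plen_eq nx cyc _; move: lag; rewrite cE /=; lia.
Qed.

End Main.

Theorem theorem2 (G : groupType) (E : finDigraph) (X : selfSimilarGraph G E)
    (Efree : source_free E)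
    (Xfree : pseudo_free X)
    (Gcomm : forall g h : G, g * h = h * g)
    (Gcount : countable [set: G])
    (Ginf : exists g : G, forall n : nat, (0 < n)%N -> g ^+ n <> 1) :
  [/\ [/\ open (Ssym X), abelian_subgroupoid (Ssym X),
        normal_subgroupoid (Ssym X) (Iso X)° &
        normal_subgroupoid (Ssym X) setT],
      (Iso X)° = Ssym X `|` Snonsym X,
      Ssym X `&` Snonsym X = set0 &
      forall (mu : finpath E) (g : G) (nu : finpath E),
        cycline X mu g nu -> mu <> nu ->
        exists c : groupoid X, cylinder X mu g nu = [set c]].
Proof.
split; last by move=> mu g nu; exact: cylinder_nonsym_set1.
- split; [exact: open_Ssym | exact: abelian_Ssym | |exact: normal_Ssym].
  by apply: normal_Ssym => c /SsymP[].
- exact: interior_Iso.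
- exact: Ssym_Snonsym0.
Qed.
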